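(* Let $\mathbb{K}\in\{\mathbb{R},\mathbb{C}\}$ and let $X=c_{00}(\mathbb{Z})$ be the space of finitely supported sequences $x=(x(k))_{k\in\mathbb{Z}}$ in $\mathbb{K}$, equipped with the locally convex topology generated by the directed family of seminorms $$\|x\|_n=\max_{|k|\le n}|x(k)|,\qquad x\in X,\ n\in\mathbb{N}.$$ Each seminorm $\|\cdot\|_n$ is complete. Let $T:X\to X$ be the bilateral weighted backward shift with weights $w(k)=2$ for $k>0$ and $w(k)=\tfrac12$ for $k\le 0$, i.e. $$(Tx)(n)=\begin{cases}2\,x(n+1), & n\ge 0,\\ \tfrac12\,x(n+1), & n<0.\end{cases}$$ Then $T\in \mathrm{GL}(X)$, $T$ is generalized hyperbolic, and $T$ has neither the positive shadowing property nor the shadowing property. In particular, there exist a locally convex space whose topology is generated by a countable family of complete seminorms and a generalized hyperbolic operator on it which does not have the shadowing property.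
   Context: A seminorm $\|\cdot\|$ on a vector space $X$ is complete if every sequence that is Cauchy with respect to $\|\cdot\|$ converges with respect to $\|\cdot\|$ to some element of $X$. $\mathrm{GL}(X)$ is the set of invertible continuous linear operators on $X$ with continuous inverse. Generalized hyperbolic: Let $X$ be a locally convex space whose topology is induced by a directed family $(\|\cdot\|_\alpha)_{\alpha\in I}$ of seminorms, and let $T:X\to X$ be a continuous linear operator. $T$ is generalized hyperbolic if $X$ is a topological direct sum $X=M\oplus N$ of two subspaces such that: (1) $T(M)\subset M$; (2) $T(N)\supset N$ and $T|_N:N\to T(N)$ is an isomorphism (of topological vector spaces); (3) for every $\alpha\in I$ there are $\beta\in I$, $c>0$ and $t\in(0,1)$ such that for all $y\in M$, $z\in N$, $n\in\mathbb{N}_0$: $\|T^ny\|_\alpha\le ct^n\|y\|_\beta$ and $\|S^nz\|_\alpha\le ct^n\|z\|_\beta$, where $S=(T|_N)^{-1}$ (as a map into $N$, restricted to $N\subset T(N)$). Pseudotrajectories: For a neighbourhood $U$ of $0$, a $U$-pseudotrajectory of $T$ is a finite or infinite sequence $(x_j)_{i<j<k}$ in $X$ ($-\infty\le i<k\le\infty$) with at least two elements such that $Tx_j-x_{j+1}\in U$ for all $i<j<k-1$. Shadowing: $T$ has the positive shadowing property if for every neighbourhood $V$ of $0$ there is a neighbourhood $U$ of $0$ such that for every $U$-pseudotrajectory $(x_j)_{j\in\mathbb{N}_0}$ there is $x\in X$ with $x_j-T^jx\in V$ for all $j\in\mathbb{N}_0$. If $T$ is invertible, the shadowing property is defined the same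 way with $\mathbb{N}_0$ replaced by $\mathbb{Z}$. *)

(* Defs.v *)
From HB Require Import structures.
From mathcomp Require Import all_boot all_order all_algebra.
From mathcomp Require Import interval_inference complex zify.
From mathcomp Require Import boolp classical_sets functions cardinality.
#[warning="-warn-library-file-internal-analysis"]
From mathcomp Require Import unstable.
From mathcomp Require Import reals topology normedtype convex.

Set Implicit Arguments.
Unset Strict Implicit.
Unset Printing Implicit Defensive.

Import Order.TTheory GRing.Theory Num.Theory.
Import numFieldNormedType.Exports.

Local Open Scope classical_set_scope.
Local Open Scope ring_scope.
Local Open Scope convex_scope.

(** Seminorms take values in [K] itself, as norms of modules over a
    [numFieldType] do; their values are nonnegative, hence real.  Likewise
    [0 < e] and [t < 1] in [K] force [e] and [t] to be real. *)

Section Seminorms.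
Variables (K : numFieldType) (X : lmodType K).

Record is_seminorm (q : X -> K) : Prop := IsSeminorm {
  seminormD : forall x y, q (x + y) <= q x + q y;
  seminormZ : forall a x, q (a *: x) = `|a| * q x }.

Definition complete_seminorm (q : X -> K) : Prop :=
  forall u : nat -> X,
    (forall e, 0 < e ->
      exists N, forall m n, (N <= m)%N -> (N <= n)%N -> q (u m - u n) < e) ->
    exists l, forall e, 0 < e -> exists N, forall n, (N <= n)%N -> q (u n - l) < e.

Record directed_seminorms (I : Type) (p : I -> X -> K) : Prop :=
  DirectedSeminorms {
    directed_inhabited : inhabited I;
    directed_seminorm : forall i, is_seminorm (p i);
    directed_upper : forall i j, exists k,
      forall x, p i x <= p k x /\ p j x <= p k x }.

Definition seminorm_ball (q : X -> K) (x : X) (e : K) : set X :=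
  [set y | q (x - y) < e].

Definition seminorm_entourage (I : Type) (p : I -> X -> K) :
    set_system (X * X) :=
  [set A | exists i e, 0 < e /\ forall xy, p i (xy.1 - xy.2) < e -> A xy].

End Seminorms.

(** For a directed family the balls of the single seminorms form a basis of
    neighbourhoods, so no finite intersections are needed. *)
Definition induces_topology (K : numFieldType) (X : tvsType K) (I : Type)
    (p : I -> X -> K) : Prop :=
  forall (x : X) (U : set X),
    nbhs x U <-> exists i e, 0 < e /\ seminorm_ball (p i) x e `<=` U.

Section SeminormTheory.
Variables (K : numFieldType) (X : lmodType K) (q : X -> K).
Hypothesis qs : is_seminorm q.

Lemma seminorm0 : q 0 = 0.
Proof. by rewrite -(scale0r 0) (seminormZ qs) normr0 mul0r. Qed.

Lemma seminormN x : q (- x) = q x.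
Proof. by rewrite -scaleN1r (seminormZ qs) normrN1 mul1r. Qed.

Lemma seminorm_distC x y : q (x - y) = q (y - x).
Proof. by rewrite -seminormN opprB. Qed.

Lemma seminorm_ge0 x : 0 <= q x.
Proof.
have := seminormD qs x (- x); rewrite subrr seminorm0 seminormN -mulr2n.
by rewrite pmulrn_lge0.
Qed.

Lemma seminorm_triangle y x z : q (x - z) <= q (x - y) + q (y - z).
Proof. by have := seminormD qs (x - y) (y - z); rewrite addrA subrK. Qed.

Lemma seminorm_ball_convex x e : convex_set (seminorm_ball q x e).
Proof.
apply/convex_setW => y z; rewrite !inE /seminorm_ball/= => yx zx l l0 l1.
rewrite inE/=.
rewrite [X in q X](_ : _ = (x - y : convex_lmodType _) <| l |>
                           (x - z : convex_lmodType _))%R; last first.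
  rewrite opprD -[in LHS](convmm l (x : convex_lmodType _)) addrACA.
  by rewrite -scalerBr -scalerBr.
rewrite (le_lt_trans (seminormD qs _ _))// !(seminormZ qs).
rewrite (@ger0_norm _ l%:num)// (@ger0_norm _ l%:num.~) ?onem_ge0//.
rewrite -[ltRHS]mul1r -(add_onemK l%:num) [ltRHS]mulrDl.
by rewrite ltrD// ltr_pM2l// onem_gt0.
Qed.

End SeminormTheory.


Section SeminormUniformity.
Variables (K : numFieldType) (X : lmodType K) (I : Type) (p : I -> X -> K).
Hypothesis dp : directed_seminorms p.
Let ps i := directed_seminorm dp i.
Let ent := seminorm_entourage p.

Lemma pos_lower_bound (e d : K) : 0 < e -> 0 < d ->
  exists c, [/\ 0 < c, c <= e & c <= d].
Proof.
move=> e0 d0; have [led | lde] := real_leP (gtr0_real e0) (gtr0_real d0).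
  by exists e; split.
by exists d; split => //; exact: ltW.
Qed.

Lemma seminorm_entourage_filter : Filter ent.
Proof.
split.
- by have [i0] := directed_inhabited dp; exists i0, 1; split.
- move=> P Q [i [e [e0 Pe]]] [j [d [d0 Qd]]].
  have [k kij] := directed_upper dp i j.
  have [c [c0 ce cd]] := pos_lower_bound e0 d0.
  exists k, c; split=> // xy xyc; have [ki kj] := kij (xy.1 - xy.2); split.
    by apply: Pe; apply: le_lt_trans ki (lt_le_trans xyc ce).
  by apply: Qd; apply: le_lt_trans kj (lt_le_trans xyc cd).
- move=> P Q PQ [i [e [e0 Pe]]]; exists i, e; split=> // xy /Pe.
  exact: PQ.
Qed.

Lemma seminorm_entourage_diagonal A : ent A -> diagonal `<=` A.
Proof.
move=> [i [e [e0 Ae]]] [x y]; rewrite /diagonal/= => <-.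
by apply: Ae; rewrite subrr (seminorm0 (ps i)).
Qed.

Lemma seminorm_entourage_inv A : ent A -> ent A^-1%relation.
Proof.
move=> [i [e [e0 Ae]]]; exists i, e; split=> // -[x y] /= xy.
by apply: Ae; rewrite (seminorm_distC (ps i)).
Qed.

Lemma seminorm_entourage_split A : ent A ->
  exists2 B, ent B & (B \; B)%relation `<=` A.
Proof.
move=> [i [e [e0 Ae]]]; exists [set xy | p i (xy.1 - xy.2) < e / 2].
  by exists i, (e / 2); split=> //; rewrite divr_gt0.
move=> [x y] [z /= xz zy]; apply: Ae => /=.
by rewrite (le_lt_trans (seminorm_triangle (ps i) z _ _))// [e]splitr ltrD.
Qed.

Lemma seminorm_nbhsP (x : X) (U : set X) :
  nbhs_ ent x U <-> exists i e, 0 < e /\ seminorm_ball (p i) x e `<=` U.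
Proof.
split=> [[A [i [e [e0 Ae]]] AU]|[i [e [e0 eU]]]].
  by exists i, e; split=> // y xy; apply: AU; apply/xsectionP; exact: Ae.
exists [set xy | p i (xy.1 - xy.2) < e]; first by exists i, e; split.
by move=> y /xsectionP xy; exact: eU.
Qed.

End SeminormUniformity.

Section SeminormTvs.
Variables (K : numFieldType) (X : PreUniformLmodule.type K).
Variables (I : Type) (p : I -> X -> K).
Hypothesis dp : directed_seminorms p.
Hypothesis entE : @entourage X = seminorm_entourage p.
Let ps i := directed_seminorm dp i.

Lemma seminorms_nbhs (x : X) (U : set X) :
  nbhs x U <-> exists i e, 0 < e /\ seminorm_ball (p i) x e `<=` U.
Proof. by rewrite -nbhs_entourageE entE; exact: seminorm_nbhsP. Qed.

Lemma seminorms_nbhs_ball (x : X) i e :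
  0 < e -> nbhs x (seminorm_ball (p i) x e).
Proof. by move=> e0; apply/seminorms_nbhs; exists i, e; split. Qed.

Lemma seminorms_add_continuous : continuous (fun x : X * X => x.1 + x.2).
Proof.
move=> [x y] U /= /seminorms_nbhs[i [e [e0 eU]]].
have e20 : 0 < e / 2 by rewrite divr_gt0.
exists (seminorm_ball (p i) x (e / 2), seminorm_ball (p i) y (e / 2)).
  by split; exact: seminorms_nbhs_ball.
move=> [z t] [/= xz yt]; apply: eU; rewrite /seminorm_ball/= opprD addrACA.
by rewrite (le_lt_trans (seminormD (ps i) _ _))// [e]splitr ltrD.
Qed.

Lemma seminorms_scale_continuous :
  continuous (fun z : K^o * X => z.1 *: z.2).
Proof.
move=> [k x] U /= /seminorms_nbhs[i [e [e0 eU]]].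
have px0 := seminorm_ge0 (ps i) x.
pose s := `|k| + p i x + 1 + e.
have s0 : 0 < s by rewrite ltr_wpDl// !addr_ge0.
have d0 : 0 < e / s by rewrite divr_gt0.
have d1 : e / s <= 1 by rewrite ler_pdivrMr// mul1r lerDr !addr_ge0.
exists (ball k (e / s), seminorm_ball (p i) x (e / s)).
  by split; [exact: nbhsx_ballx|exact: seminorms_nbhs_ball].
move=> [l y] [/= kl xy]; apply: eU; rewrite /seminorm_ball/=.
have -> : k *: x - l *: y = k *: (x - y) + (k - l) *: y.
  by rewrite scalerBr scalerBl addrA subrK.
rewrite (le_lt_trans (seminormD (ps i) _ _))// !(seminormZ (ps i)).
have py : p i y <= p i x + 1.
  rewrite -[y](subrK x) addrC (le_trans (seminormD (ps i) _ _))// lerD2l.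
  by rewrite (seminorm_distC (ps i)) (le_trans (ltW xy)).
have kld : `|k - l| <= e / s by apply: ltW.
rewrite (@le_lt_trans _ _ (e / s * (`|k| + p i x + 1)))//.
  rewrite -addrA mulrDr lerD//.
    by rewrite mulrC ler_wpM2r// ltW.
  by rewrite ler_pM// (seminorm_ge0 (ps i)).
by rewrite mulrAC ltr_pdivrMr// ltr_pM2l// /s ltrDl.
Qed.

Lemma seminorms_locally_convex :
  exists2 B : set_system X, (forall b, b \in B -> convex_set b) & basis B.
Proof.
exists [set B | exists i x e, B = seminorm_ball (p i) x e].
  move=> B; rewrite inE => -[i [x [e ->]]].
  exact: seminorm_ball_convex (ps i) _ _.
split.
  move=> _ [i [x [e ->]]]; rewrite openE => y xy.
  apply/seminorms_nbhs; exists i, (e - p i (x - y)); split.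
    by rewrite subr_gt0.
  move=> z; rewrite /seminorm_ball/= ltrBrDl.
  exact/le_lt_trans/seminorm_triangle.
move=> x U /seminorms_nbhs[i [e [e0 eU]]].
exists (seminorm_ball (p i) x e) => //; split; first by exists i, x, e.
by rewrite /seminorm_ball/= subrr (seminorm0 (ps i)).
Qed.

End SeminormTvs.

Section Operators.
Variables (K : numFieldType).

(** [f], linear in all uses below, restricts to an isomorphism of topological
    vector spaces from [A] onto [B]. *)
Definition tvs_iso_on (X Y : tvsType K) (A : set X) (B : set Y) (f : X -> Y) :
    Prop :=
  [/\ set_bij A B f, {within A, continuous f} &
      {within B, continuous ('pinv_(fun=> 0) A f : Y -> X)}].

Variable X : tvsType K.

Definition is_subspace (M : set X) : Prop :=
  [/\ M 0, forall x y, M x -> M y -> M (x + y) &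
      forall (a : K) x, M x -> M (a *: x)].

Definition topological_direct_sum (M N : set X) : Prop :=
  [/\ is_subspace M, is_subspace N &
      tvs_iso_on (M `*` N) [set: X] (fun yz : X * X => yz.1 + yz.2)].

Definition inv_op (T : X -> X) : X -> X := 'pinv_(fun=> 0) [set: X] T.

Definition in_GL (T : {linear X -> X}) : Prop :=
  [/\ continuous T, bijective T & continuous (inv_op T)].

Definition generalized_hyperbolic (I : Type) (p : I -> X -> K)
    (T : {linear X -> X}) : Prop :=
  exists M N : set X,
    [/\ topological_direct_sum M N,
        T @` M `<=` M,
        N `<=` T @` N /\ tvs_iso_on N (T @` N) T &
        forall i, exists j (c t : K),
          [/\ 0 < c, 0 < t < 1,
              forall (y : X) (n : nat), M y ->
                p i (iter n T y) <= c * t ^+ n * p j y &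
              forall (z : X) (n : nat), N z ->
                p i (iter n ('pinv_(fun=> 0) N T) z) <= c * t ^+ n * p j z]].

(** A sequence indexed by the integers of an interval [J] is represented by a
    total function on [int] of which only the values on [J] matter. *)
Definition pseudotrajectory (T : X -> X) (U : set X) (J : interval int)
    (x : int -> X) : Prop :=
  (exists j, j \in J /\ j + 1 \in J) /\
  forall j, j \in J -> j + 1 \in J -> U (T (x j) - x (j + 1)).

Definition positive_shadowing (T : {linear X -> X}) : Prop :=
  forall V : set X, nbhs 0 V -> exists U : set X, nbhs 0 U /\
    forall x : int -> X, pseudotrajectory T U `[0, +oo[ x ->
      exists a : X, forall j : nat, V (x j - iter j T a).

Definition iterz (T : X -> X) (j : int) : X -> X :=
  match j with
  | Posz n => iter n T
  | Negz n => iter n.+1 (inv_op T)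
  end.

(** Meaningful for bijective [T] only: otherwise [inv_op T] is a junk inverse. *)
Definition shadowing (T : {linear X -> X}) : Prop :=
  forall V : set X, nbhs 0 V -> exists U : set X, nbhs 0 U /\
    forall x : int -> X, pseudotrajectory T U `]-oo, +oo[ x ->
      exists a : X, forall j : int, V (x j - iterz T j a).

End Operators.

Section C00.
Variable K : numFieldType.

Definition finitely_supported : {pred int -> K} :=
  [pred x : int -> K | `[< finite_set [set k | x k != 0] >]].

Lemma finitely_supported_submod : GRing.submod_closed finitely_supported.
Proof.
split.
  apply/asboolP; rewrite (_ : [set k | _] = set0); first exact: finite_set0.
  by rewrite -subset0 => k /=; rewrite eqxx.
move=> a x y /asboolP xf /asboolP yf; apply/asboolP.
apply: (@sub_finite_set _ _ ([set k | x k != 0] `|` [set k | y k != 0])).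
  move=> k /=; apply: contraPP => /not_orP[/negP/negPn/eqP xk0 /negP/negPn/eqP yk0].
  by apply/negP; rewrite negbK -[(a *: x + y) k]/(a * x k + y k) xk0 yk0 mulr0 addr0.
by rewrite finite_setU.
Qed.

HB.instance Definition _ :=
  GRing.isSubmodClosed.Build K (int -> K) finitely_supported
    finitely_supported_submod.

Record c00 := C00 {
  c00_val :> int -> K;
  c00_valP : c00_val \in finitely_supported }.

HB.instance Definition _ := [isSub for c00_val].
HB.instance Definition _ := [Choice of c00 by <:].
HB.instance Definition _ := [SubChoice_isSubLmodule of c00 by <:].

Lemma c00P (x y : c00) : (forall k, x k = y k) -> x = y.
Proof. by move=> xy; apply: val_inj; apply/funext. Qed.

Lemma c00D (x y : c00) k : (x + y) k = x k + y k.
Proof. by []. Qed.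

Lemma c00Z a (x : c00) k : (a *: x) k = a * x k.
Proof. by []. Qed.

Lemma c00B (x y : c00) k : (x - y) k = x k - y k.
Proof. by []. Qed.

(** The index [i] stands for the integer [k = i - n], [|k| <= n]. *)
Definition c00_norm (n : nat) (x : c00) : K :=
  (\big[Order.max/0%:nng]_(i < n.*2.+1) `|x (i%:Z - n%:Z)|%:nng)%:num.

(** The index set of the family is [{1, 2, 3, ...}]. *)
Definition c00_seminorms (n : nat) : c00 -> K := c00_norm n.+1.

Lemma c00_norm_le n (x : c00) (e : K) : 0 <= e ->
  reflect (forall k : int, `|k| <= n%:Z -> `|x k| <= e) (c00_norm n x <= e).
Proof.
move=> e0; apply: (iffP idP); rewrite /c00_norm -[e]/((NngNum e0)%:num) num_le.
  move=> /bigmax_leP[_ xE] k kn.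
  have k0 : 0 <= k + n%:Z by lia.
  have i_lt : (absz (k + n%:Z)%R < n.*2.+1)%N by lia.
  have /= := xE (Ordinal i_lt) isT; rewrite -num_le/= gez0_abs// addrK.
  exact.
move=> xE; apply/bigmax_leP; split=> [|i _]; first by rewrite -num_le.
by rewrite -num_le/=; apply: xE; have := ltn_ord i; lia.
Qed.

Lemma c00_seminorms_directed : directed_seminorms c00_seminorms.
Proof.
have norm_ge0 n x : 0 <= c00_norm n x by rewrite /c00_norm.
have norm_ub n (x : c00) (k : int) : `|k| <= n%:Z -> `|x k| <= c00_norm n x.
  have /c00_norm_le H := lexx (c00_norm n x); exact: H.
split; first exact: inhabits 0%N.
  move=> n; split=> [x y|a x]; rewrite /c00_seminorms.
    apply/c00_norm_le => [|k kn]; first by rewrite addr_ge0.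
    by rewrite c00D (le_trans (ler_normD _ _))// lerD// norm_ub.
  apply/le_anti/andP; split.
    apply/c00_norm_le => [|k kn]; first by rewrite mulr_ge0.
    by rewrite c00Z normrM ler_wpM2l// norm_ub.
  have [->|a0] := eqVneq a 0; first by rewrite normr0 mul0r.
  rewrite -ler_pdivlMl ?normr_gt0//; apply/c00_norm_le => [|k kn].
    by rewrite mulr_ge0// invr_ge0.
  by rewrite ler_pdivlMl ?normr_gt0// -normrM -c00Z norm_ub.
move=> i j; exists (maxn i j) => x; rewrite /c00_seminorms.
split; apply/c00_norm_le => [|k kn]; rewrite ?norm_ge0//;
  apply: norm_ub; apply: le_trans kn _; rewrite lez_nat ltnS.
- exact: leq_maxl.
- exact: leq_maxr.
Qed.

HB.instance Definition _ := isUniform.Build c00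
  (seminorm_entourage_filter c00_seminorms_directed)
  (seminorm_entourage_diagonal c00_seminorms_directed)
  (seminorm_entourage_inv c00_seminorms_directed)
  (seminorm_entourage_split c00_seminorms_directed).

HB.instance Definition _ :=
  PreTopologicalNmodule_isTopologicalNmodule.Build c00
    (seminorms_add_continuous c00_seminorms_directed erefl).
HB.instance Definition _ :=
  TopologicalNmodule_isTopologicalLmodule.Build K c00
    (seminorms_scale_continuous c00_seminorms_directed erefl).
HB.instance Definition _ := Uniform_isTvs.Build K c00
  (seminorms_locally_convex c00_seminorms_directed erefl).

(** The topology carried by [c00] is the one generated by its seminorms. *)
Lemma c00_induces : induces_topology c00_seminorms.
Proof. by move=> x U; exact: seminorms_nbhs. Qed.

Section Shift.
Variable w : int -> K.

Lemma bshift_subproof (x : c00) :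
  (fun n => w (n + 1) * x (n + 1)) \in finitely_supported.
Proof.
have /asboolP xf := c00_valP x; apply/asboolP.
apply: (@sub_finite_set _ _ ((fun k => k - 1) @` [set k | x k != 0])).
  move=> n /=; rewrite mulf_eq0 negb_or => /andP[_ xn].
  by exists (n + 1); rewrite ?addrK.
exact: finite_image.
Qed.

(** The bilateral weighted backward shift, [e_k |-> w k *: e_(k-1)]. *)
Definition bshift (x : c00) : c00 := C00 (bshift_subproof x).

Lemma bshift_linear : linear bshift.
Proof.
move=> a x y; apply: c00P => k; rewrite c00D c00Z.
rewrite -[LHS]/(w (k + 1) * (a * x (k + 1) + y (k + 1))) mulrDr mulrCA.
by [].
Qed.

HB.instance Definition _ :=
  GRing.isLinear.Build K c00 c00 *:%R bshift bshift_linear.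

End Shift.

Definition weight (k : int) : K := if 0 < k then 2 else 2^-1.

Definition c00_shift : {linear c00 -> c00} := bshift weight.

Lemma c00_shiftE (x : c00) (n : int) :
  c00_shift x n = if 0 <= n then 2 * x (n + 1) else 2^-1 * x (n + 1).
Proof. by rewrite /= /weight ltzD1; case: ifP. Qed.

End C00.

(* Main.v *)
(** The shift contracts the sequences supported in [k <= 0] by [1/2], and its
    inverse contracts those supported in [k > 0] by [1/2]; restriction of
    supports splits [c00] accordingly.  A Cauchy sequence for a single seminorm
    constrains finitely many coordinates only, so completeness is that of [K].

    On [K^int] the shift fixes [sum_k 2^-|k| e_k].  Cutting this vector outside
    a large window changes nothing that a given seminorm sees, so the constant
    sequence of its truncations is a pseudotrajectory for an arbitrarily small
    error; its coordinate [0] is always [1].  But coordinate [0] of the orbit of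
    [a] at time [j] is [2^j a(j)], which vanishes for large [j] as [a] has
    finite support. *)

Require Import Defs.
From HB Require Import structures.
From mathcomp Require Import all_boot all_order all_algebra.
From mathcomp Require Import interval_inference complex zify.
From mathcomp Require Import boolp classical_sets functions cardinality.
From mathcomp Require Import reals topology normedtype.

Set Implicit Arguments.
Unset Strict Implicit.
Unset Printing Implicit Defensive.

Import Order.TTheory GRing.Theory Num.Theory.
Import numFieldNormedType.Exports.

Local Open Scope classical_set_scope.
Local Open Scope ring_scope.

(** * Completeness of the real and complex scalars *)

Lemma complete_norm_real (R : realType) :
  complete_seminorm (fun x : (R : numFieldType)^o => `|x|).
Proof.
move=> u uC.
have /cauchy_cvg uF : cauchy (u @ \oo : set_system R).
  apply: cauchy_exP => e e0; have [N uN] := uC e e0.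
  by exists (u N), N => // n /= Nn; exact: uN.
exists (lim (u @ \oo : set_system R)) => e e0.
have /cvgrPdist_lt/(_ e e0)[N _ uN] :
  (u : nat -> R) @ \oo --> lim (u @ \oo : set_system R) by [].
by exists N => n Nn; rewrite distrC; exact: uN.
Qed.

Lemma normc_ge_Im (R : rcfType) (z : R[i]) : `|complex.Im z|%:C%C <= `|z|.
Proof. by rewrite normc_def lecR -sqrtr_sqr ler_wsqrtr// lerDr sqr_ge0. Qed.

Lemma normc_le_ReIm (R : rcfType) (z : R[i]) :
  `|z| <= (`|complex.Re z| + `|complex.Im z|)%:C%C.
Proof.
rewrite normc_def lecR -[leRHS]ger0_norm ?addr_ge0// -[leRHS]sqrtr_sqr.
apply: ler_wsqrtr; rewrite sqrrD !real_normK ?num_real// addrAC lerDl.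
by rewrite mulrn_wge0// mulr_ge0.
Qed.

(** Both coordinate projections are dominated by the modulus, so they send Cauchy sequences to
    Cauchy sequences; the modulus is in turn at most the sum of the two parts. *)
Lemma complete_norm_complex (R : realType) :
  complete_seminorm (fun x : (R[i] : numFieldType)^o => `|x|).
Proof.
move=> u uC.
have part (f : R[i] -> R) : {morph f : x y / x - y} ->
    (forall z, `|f z|%:C%C <= `|z|) ->
    exists l, forall e, 0 < e ->
      exists N, forall n, (N <= n)%N -> `|f (u n) - l| < e.
  move=> fB f_le; apply: (@complete_norm_real R) => e e0.
  have [|N uN] := uC e%:C%C; first by rewrite ltcR.
  exists N => m n Nm Nn; rewrite -ltcR -fB.
  exact: le_lt_trans (f_le _) (uN _ _ Nm Nn).
have [||a ua] := part (@complex.Re R).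
- by move=> [? ?] [? ?].
- exact: normc_ge_Re.
have [||b ub] := part (@complex.Im R).
- by move=> [? ?] [? ?].
- exact: normc_ge_Im.
(* Positivity in [R[i]] forces the imaginary part [e'] to vanish. *)
exists (a +i* b)%C => -[e e']; rewrite ltcE/= => /andP[/eqP-> e0].
have e20 : 0 < e / 2 by rewrite divr_gt0.
have [N uN] := ua _ e20; have [N' uN'] := ub _ e20.
exists (maxn N N') => n; rewrite geq_max => /andP[Nn Nn'].
apply: le_lt_trans (normc_le_ReIm _) _.
rewrite complexr0 ltcR [e]splitr.
by move: (uN _ Nn) (uN' _ Nn'); case: (u n) => x y /=; exact: ltrD.
Qed.

(** * Criteria for isomorphisms and for continuity *)

Section TvsMaps.
Variables (K : numFieldType) (X Y : tvsType K).

Lemma pinv_eq (A : set X) (f : X -> Y) (x : X) :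
  {in A &, injective f} -> A x -> 'pinv_(fun=> 0) A f (f x) = x.
Proof. by move=> fI Ax; rewrite pinvKV// inE. Qed.

(** On [B] the partial inverse ['pinv_] of [tvs_iso_on] agrees with [g], so it inherits the
    continuity of [g]. *)
Lemma tvs_iso_on_can (A : set X) (B : set Y) (f : X -> Y) (g : Y -> X) :
  (forall x, A x -> B (f x)) -> (forall y, B y -> A (g y)) ->
  {in A, cancel f g} -> {in B, cancel g f} ->
  continuous f -> continuous g -> tvs_iso_on A B f.
Proof.
move=> AB BA fK gK fC gC.
have fI : {in A &, injective f} by exact: can_in_inj fK.
split; last 1 first.
- apply: (@subspace_eq_continuous _ _ _ g) => [y|]; last first.
    exact: continuous_subspaceT.
  move=> yB; rewrite /from_subspace -[in RHS](gK _ yB) pinv_eq//; apply: BA.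
  by rewrite inE in yB.
- split=> // y By; exists (g y); first exact: BA.
  by rewrite gK// inE.
- exact: continuous_subspaceT.
Qed.

Lemma seminorm_bounded_continuous (I J : Type) (p : I -> X -> K)
    (q : J -> Y -> K) (f : {linear X -> Y}) :
  induces_topology p -> induces_topology q ->
  (forall j, exists i c, 0 < c /\ forall x, q j (f x) <= c * p i x) ->
  continuous f.
Proof.
move=> pX qY fb x U /qY[j [e [e0 eU]]]; apply/pX.
have [i [c [c0 fc]]] := fb j.
exists i, (e / c); split; first by rewrite divr_gt0.
move=> y xy; apply: eU; rewrite /seminorm_ball/= -linearB.
by rewrite (le_lt_trans (fc _))// mulrC -ltr_pdivlMr.
Qed.

End TvsMaps.

(** * Topology of [c00] and completeness of its seminorms *)

Section C00.
Variable K : numFieldType.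
Local Notation c00 := (c00 K).
Implicit Types (x y : c00) (n : nat) (k : int).

Lemma c00_norm_ge0 n x : 0 <= c00_norm n x.
Proof. by rewrite /c00_norm. Qed.

Lemma le_c00_norm n x k : `|k| <= n%:Z -> `|x k| <= c00_norm n x.
Proof. exact/c00_norm_le/lexx/c00_norm_ge0. Qed.

Lemma c00_norm_lt n x k (e : K) :
  c00_norm n x < e -> `|k| <= n%:Z -> `|x k| < e.
Proof. by move=> xe kn; apply: le_lt_trans xe; exact: le_c00_norm. Qed.

(** The larger window [n.+1] leaves room for maps that move coordinates by one. *)
Lemma c00_linear_continuous (f : {linear c00 -> c00}) (c : K) :
  0 < c -> (forall n x, c00_norm n (f x) <= c * c00_norm n.+1 x) ->
  continuous f.
Proof.
move=> c0 fc.
apply: seminorm_bounded_continuous (@c00_induces K) (@c00_induces K) _.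
by move=> n; exists n.+1, c; split=> // x; exact: fc.
Qed.

(** Points that differ at [k] are separated by balls of radius half the gap, for a seminorm that
    sees [k]. *)
Lemma c00_hausdorff : hausdorff_space c00.
Proof.
move=> x y xy; apply: c00P => k; apply/eqP/negPn/negP; rewrite -subr_eq0 => xyk.
pose e := `|x k - y k| / 2; have e0 : 0 < e by rewrite divr_gt0// normr_gt0.
have ball_nbhs z : nbhs z (seminorm_ball (c00_seminorms `|k|%N) z e).
  by apply/c00_induces; exists `|k|%N, e; split.
have [z [xz yz]] := xy _ _ (ball_nbhs x) (ball_nbhs y).
have kk : `|k| <= (absz k).+1%:Z by lia.
have /(_ _ kk) := c00_norm_lt xz; have /(_ _ kk) := c00_norm_lt yz.
rewrite !c00B => yzk xzk.
have := ltrD xzk yzk; rewrite [`|y k - z k|]distrC /e -splitr.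
by move=> /(le_lt_trans (ler_distD _ _ _)); rewrite ltxx.
Qed.

Lemma interval_finite_set n : finite_set [set k : int | `|k| <= n%:Z].
Proof.
apply: (@sub_finite_set _ _ ((fun i : nat => i%:Z - n%:Z) @` `I_(n.*2.+1))).
  by move=> k /= kn; exists (absz (k + n%:Z)); lia.
exact/finite_image/finite_II.
Qed.

Lemma c00_trunc_subproof n (f : int -> K) :
  (fun k => if `|k| <= n%:Z then f k else 0) \in @finitely_supported K.
Proof.
apply/asboolP; apply: sub_finite_set (interval_finite_set n) => k /=.
by case: ifP => //; rewrite eqxx.
Qed.

Definition c00_trunc n (f : int -> K) : c00 := C00 (c00_trunc_subproof n f).

Lemma c00_truncE n f k : `|k| <= n%:Z -> c00_trunc n f k = f k.
Proof. by rewrite /= => ->. Qed.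

(** The limit is taken coordinatewise inside the window and set to 0 outside it, where the seminorm
    sees nothing. *)
Lemma complete_c00_norm n :
  complete_seminorm (fun a : K^o => `|a|) -> complete_seminorm (@c00_norm K n).
Proof.
move=> KC u uC.
have coord k : exists l : K, `|k| <= n%:Z -> forall e : K, 0 < e ->
    exists N, forall m, (N <= m)%N -> `|u m k - l| < e.
  have [kn|nk] := boolP (`|k| <= n%:Z); last by exists 0.
  have [|l ul] := KC (fun m => u m k); last by exists l.
  move=> e /uC[N uN]; exists N => m m' Nm Nm'.
  by rewrite -c00B; apply: c00_norm_lt kn; exact: uN.
have [l ul] := choice coord.
exists (c00_trunc n l) => e e0; have e20 : 0 < e / 2 by rewrite divr_gt0.
have rank k : exists N, `|k| <= n%:Z ->
    forall m, (N <= m)%N -> `|u m k - l k| < e / 2.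
  have [kn|nk] := boolP (`|k| <= n%:Z); last by exists 0%N.
  by have [N uN] := ul k kn _ e20; exists N.
have [N uN] := choice rank.
exists (\max_(i < n.*2.+1) N (i%:Z - n%:Z)%R) => m /bigmax_leqP Nm.
(* [c00_norm_le] yields only nonstrict bounds, hence the margin [e / 2]. *)
apply: (@le_lt_trans _ _ (e / 2)); last first.
  by rewrite ltr_pdivrMr// ltr_pMr// ltr1n.
apply/c00_norm_le => [|k kn]; first exact: ltW.
rewrite c00B c00_truncE// ltW// uN//.
have i_lt : (absz (k + n%:Z)%R < n.*2.+1)%N by lia.
have := Nm (Ordinal i_lt) isT; rewrite /= gez0_abs ?addrK//; lia.
Qed.

(** * Splitting [c00] by supports *)

Lemma c00_restrict_subproof (P : pred int) x :
  (fun k => if P k then x k else 0) \in @finitely_supported K.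
Proof.
have /asboolP xf := c00_valP x; apply/asboolP; apply: sub_finite_set xf => k /=.
by case: ifP => //; rewrite eqxx.
Qed.

Definition c00_restrict (P : pred int) x : c00 :=
  C00 (c00_restrict_subproof P x).

Lemma c00_restrictE P x k : c00_restrict P x k = if P k then x k else 0.
Proof. by []. Qed.

Lemma c00_restrict_linear P : linear (c00_restrict P).
Proof.
move=> a x y; apply: c00P => k; rewrite c00D c00Z /=; case: ifP => // _.
by rewrite mulr0 addr0.
Qed.

HB.instance Definition _ P :=
  GRing.isLinear.Build K c00 c00 *:%R (c00_restrict P) (c00_restrict_linear P).

Lemma c00_norm_leS n x : c00_norm n x <= c00_norm n.+1 x.
Proof.
apply/c00_norm_le => [|k kn]; first exact: c00_norm_ge0.
by apply: le_c00_norm; lia.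
Qed.

Lemma c00_restrict_continuous P : continuous (c00_restrict P).
Proof.
apply: (@c00_linear_continuous _ 1) => // n x; rewrite mul1r.
apply: le_trans (c00_norm_leS n x).
apply/c00_norm_le => [|k kn]; first exact: c00_norm_ge0.
by rewrite /=; case: ifP => _; rewrite ?normr0 ?c00_norm_ge0// le_c00_norm.
Qed.

Definition c00_supported (P : pred int) : set c00 :=
  [set x | forall k, ~~ P k -> x k = 0].

Lemma c00_supported_subspace P : is_subspace (c00_supported P).
Proof.
split=> [//|x y xP yP k Pk|a x xP k Pk].
  by rewrite c00D xP// yP// addr0.
by rewrite c00Z xP// mulr0.
Qed.

(** Addition is inverted by the pair of restrictions, continuous because restricting increases no
    seminorm. *)
Lemma c00_direct_sum P :
  topological_direct_sum (c00_supported P) (c00_supported (predC P)).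
Proof.
split; [exact: c00_supported_subspace|exact: c00_supported_subspace|].
apply: (@tvs_iso_on_can _ _ _ _ _ _
  (fun x => (c00_restrict P x, c00_restrict (predC P) x))) => //=.
- by move=> x _; split=> k /= /negPf->.
- move=> [x y]; rewrite inE => -[/= xP yP].
  congr pair; apply: c00P => k; rewrite c00_restrictE c00D /=.
    by case: ifPn => Pk; [rewrite yP ?addr0//= negbK|rewrite xP].
  by case: ifPn => Pk; [rewrite xP ?add0r|rewrite yP//=].
- move=> x _; apply: c00P => k; rewrite c00D /=.
  by case: (P k); rewrite ?addr0 ?add0r.
- exact: add_continuous.
- move=> x.
  exact: cvg_pair (@c00_restrict_continuous P x)
    (@c00_restrict_continuous (predC P) x).
Qed.

(** * Weighted shifts and their inverses *)

Section Shift.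
Variable w : int -> K.
Hypothesis w0 : forall k, w k != 0.

Lemma fshift_subproof x :
  (fun k => (w k)^-1 * x (k - 1)) \in @finitely_supported K.
Proof.
have /asboolP xf := c00_valP x; apply/asboolP.
apply: (@sub_finite_set _ _ ((fun k => k + 1) @` [set k | x k != 0])).
  move=> k /=; rewrite mulf_eq0 negb_or => /andP[_ xk].
  by exists (k - 1); rewrite ?subrK.
exact: finite_image.
Qed.

Definition fshift x : c00 := C00 (fshift_subproof x).

Lemma bshiftK : cancel (bshift w) fshift.
Proof. by move=> x; apply: c00P => k /=; rewrite subrK mulKf. Qed.

Lemma fshiftK : cancel fshift (bshift w).
Proof. by move=> x; apply: c00P => k /=; rewrite addrK mulVKf. Qed.

HB.instance Definition _ := GRing.isLinear.Build K c00 c00 *:%R fshift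
  (can2_linear bshiftK fshiftK).

Lemma bshift_continuous (c : K) :
  0 < c -> (forall k, `|w k| <= c) -> continuous (bshift w).
Proof.
move=> c0 wc; apply: (c00_linear_continuous c0) => n x.
apply/c00_norm_le => [|k kn]; first by rewrite mulr_ge0 ?c00_norm_ge0 ?ltW.
by rewrite normrM ler_pM// le_c00_norm//; lia.
Qed.

Lemma fshift_continuous (c : K) :
  0 < c -> (forall k, `|(w k)^-1| <= c) -> continuous fshift.
Proof.
move=> c0 wc; apply: (c00_linear_continuous c0) => n x.
apply/c00_norm_le => [|k kn]; first by rewrite mulr_ge0 ?c00_norm_ge0 ?ltW.
by rewrite normrM ler_pM// le_c00_norm//; lia.
Qed.

End Shift.

(** * Invertibility of the shift [T] *)

Local Notation w := (@weight K).
Local Notation T := (c00_shift K).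
Local Notation S := (fshift w).

Lemma weight_neq0 k : w k != 0.
Proof. by rewrite /weight; case: ifP; rewrite ?invr_eq0 pnatr_eq0. Qed.

Let TK : cancel T S. Proof. exact/bshiftK/weight_neq0. Qed.
Let SK : cancel S T. Proof. exact/fshiftK/weight_neq0. Qed.

Let half_le2 : (2^-1 : K) <= 2.
Proof. by rewrite (@le_trans _ _ 1)// ?invf_le1// ler1n. Qed.

Lemma c00_shift_continuous : continuous T.
Proof.
apply: (@bshift_continuous _ 2) => // k.
by rewrite /weight; case: ifP => _; rewrite ger0_norm.
Qed.

Lemma c00_shift_inv_continuous : continuous S.
Proof.
apply: (@fshift_continuous _ weight_neq0 2) => // k.
by rewrite /weight; case: ifP => _; rewrite ?invrK ger0_norm.
Qed.

Lemma inv_c00_shiftE x : inv_op T x = S x.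
Proof.
by rewrite -{1}(SK x) /inv_op pinv_eq// => y z _ _; exact: (can_inj TK).
Qed.

Lemma c00_shift_in_GL : in_GL T.
Proof.
split; [exact: c00_shift_continuous|by exists S|].
rewrite (_ : inv_op T = S); first exact: c00_shift_inv_continuous.
by apply/funext => x; exact: inv_c00_shiftE.
Qed.

(** * Contraction estimates and generalized hyperbolicity *)

Lemma iter_contraction (E : set c00) (f : c00 -> c00) (q : c00 -> K) (t : K) :
  0 <= t -> (forall x, E x -> E (f x) /\ q (f x) <= t * q x) ->
  forall x n, E x -> q (iter n f x) <= t ^+ n * q x.
Proof.
move=> t0 fE x n Ex.
suff [] : E (iter n f x) /\ q (iter n f x) <= t ^+ n * q x by [].
elim: n => [|n [En qn]] /=; first by rewrite expr0 mul1r.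
have [Efn qfn] := fE _ En; split=> //; apply: le_trans qfn _.
by rewrite exprS -mulrA ler_wpM2l.
Qed.

Local Notation M := (c00_supported (fun k => k <= 0)).
Local Notation N := (c00_supported (predC (fun k => k <= 0))).

(** Only coordinates [k + 1 <= 0] contribute; they have weight 1/2 and satisfy [|k + 1| <= |k|], so
    the window need not grow. *)
Lemma c00_shift_stable n x : M x ->
  M (T x) /\ c00_norm n (T x) <= 2^-1 * c00_norm n x.
Proof.
move=> Mx; split=> [k k0|].
  by rewrite /= Mx ?mulr0//; move: k0 => /=; lia.
apply/c00_norm_le => [|k kn]; first by rewrite mulr_ge0 ?c00_norm_ge0.
rewrite /= /weight; case: ifPn => k0.
  by rewrite Mx ?mulr0 ?normr0 ?mulr_ge0 ?c00_norm_ge0// -ltNge.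
by rewrite normrM ger0_norm// ler_wpM2l// le_c00_norm//; lia.
Qed.

(** Mirror image: only [k > 1] contributes, with inverse weight 1/2 and [|k - 1| <= |k|]. *)
Lemma c00_shift_inv_stable n x : N x ->
  N (S x) /\ c00_norm n (S x) <= 2^-1 * c00_norm n x.
Proof.
move=> Nx; split=> [k k0|].
  by rewrite /= Nx ?mulr0//; move: k0 => /=; lia.
apply/c00_norm_le => [|k kn]; first by rewrite mulr_ge0 ?c00_norm_ge0.
rewrite /= /weight; case: ifPn => k0; last first.
  by rewrite Nx ?mulr0 ?normr0 ?mulr_ge0 ?c00_norm_ge0//=; lia.
by rewrite normrM ger0_norm// ler_wpM2l// le_c00_norm//; lia.
Qed.

Lemma c00_shift_generalized_hyperbolic :
  generalized_hyperbolic (@c00_seminorms K) T.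
Proof.
have NTN : N `<=` T @` N.
  by move=> z /(c00_shift_inv_stable 0)[Nz _]; exists (S z).
exists M, N; split.
- exact: c00_direct_sum.
- by move=> _ [x Mx <-]; have [] := c00_shift_stable 0 Mx.
- split=> //; apply: (@tvs_iso_on_can _ _ _ _ _ _ S).
  + by move=> x Nx; exists x.
  + by move=> _ [x Nx <-]; rewrite TK.
  + by move=> x _; exact: TK.
  + by move=> x _; exact: SK.
  + exact: c00_shift_continuous.
  + exact: c00_shift_inv_continuous.
(* Each seminorm is contracted against itself, so the index stays the same and the constant is 1. *)
move=> n; exists n, 1, 2^-1.
(* [S z] lies in [N] for [z] in [N], so it is the preimage that ['pinv_] picks. *)
have pinvE z : N z -> 'pinv_(fun=> 0) N T z = S z.
  move=> Nz; rewrite -{1}(SK z) pinv_eq//; last first.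
    by have [] := c00_shift_inv_stable 0 Nz.
  by move=> x y _ _; exact: (can_inj TK).
split=> // [|x m Mx|z m Nz]; rewrite ?mul1r.
- by rewrite invr_gt0 ltr0n invf_lt1// ltr1n.
- by apply: (@iter_contraction M) Mx => // y; exact: c00_shift_stable.
- apply: (@iter_contraction N) Nz => // y Ny; rewrite pinvE//.
  exact: c00_shift_inv_stable.
Qed.

(** * Failure of shadowing *)

Lemma iter_c00_shift0 (j : nat) x : iter j T x 0 = 2 ^+ j * x j.
Proof.
(* The induction needs every coordinate [n >= 0]; the weight met there is always 2. *)
suff H n : iter j T x n%:Z = 2 ^+ j * x (n%:Z + j%:Z) by rewrite H add0r.
elim: j n => [|j IHj] n; first by rewrite expr0 mul1r addr0.
rewrite iterS c00_shiftE /= (_ : n%:Z + 1 = n.+1%:Z); last by lia.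
by rewrite IHj mulrA -exprS (_ : n.+1%:Z + j%:Z = n%:Z + j.+1%:Z)//; lia.
Qed.

Lemma c00_nat_zero x : exists j : nat, x j = 0.
Proof.
apply: contrapT => xN; apply: infinite_nat.
have /asboolP xf := c00_valP x.
rewrite (_ : setT = Posz @^-1` [set k | x k != 0]).
  by apply: finite_preimage xf => i j _ _ [].
by apply/seteqP; split=> // j _ /=; apply/eqP => xj; apply: xN; exists j.
Qed.

(** The cut is at [n.+1] because [T] reads coordinate [k + 1] at [k]: the defect then vanishes for
    [|k| <= n]. *)
Definition almost_fixed n : c00 := c00_trunc n.+1 (fun k => 2^-1 ^+ absz k).

Lemma almost_fixedP n : c00_norm n (T (almost_fixed n) - almost_fixed n) = 0.
Proof.
apply/le_anti; rewrite c00_norm_ge0 andbT; apply/c00_norm_le => // k kn.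
rewrite c00B c00_shiftE !c00_truncE; [|lia|lia].
suff -> : (if 0 <= k then 2 * 2^-1 ^+ absz (k + 1)
           else 2^-1 * 2^-1 ^+ absz (k + 1)) = 2^-1 ^+ absz k :> K
  by rewrite subrr normr0.
case: ifPn => k0.
  by rewrite (_ : absz (k + 1) = (absz k).+1) ?exprS ?mulVKf ?pnatr_eq0//; lia.
by rewrite (_ : absz k = (absz (k + 1)).+1) ?exprS//; lia.
Qed.

Lemma almost_fixed0 n : almost_fixed n 0 = 1.
Proof. by rewrite c00_truncE. Qed.

(** Stated for any interval containing 0 and 1, to serve both shadowing properties; the failure
    occurs at a time [j >= 0] in either case. *)
Lemma c00_shift_not_shadowed (J : interval int) :
  0 \in J -> 0 + 1 \in J ->
  exists2 V : set c00, nbhs 0 V & forall U : set c00, nbhs 0 U ->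
    exists2 x : int -> c00, pseudotrajectory T U J x &
      forall a : c00, exists j : nat, ~ V (x j - iter j T a).
Proof.
(* This ball forces coordinate 0 to stay below 1 in modulus. *)
move=> J0 J1; exists (seminorm_ball (c00_seminorms 0) 0 1).
  by apply/c00_induces; exists 0%N, 1; split.
(* [c00_seminorms n] is [c00_norm n.+1], so with [almost_fixed n.+1] the error has seminorm exactly
   0. *)
move=> U /c00_induces[n [e [e0 eU]]]; exists (fun=> almost_fixed n.+1).
  split=> [|j _ _]; first by exists 0.
  apply: eU; rewrite /seminorm_ball/= sub0r.
  rewrite (seminormN (directed_seminorm (c00_seminorms_directed K) n)).
  by rewrite /c00_seminorms almost_fixedP.
(* Where [a] vanishes at [j], coordinate 0 of the difference at time [j] is [1 - 2^j * 0 = 1]. *)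
move=> a; have [j aj] := c00_nat_zero a; exists j.
rewrite /seminorm_ball /mkset sub0r.
rewrite (seminormN (directed_seminorm (c00_seminorms_directed K) 0)).
move=> /c00_norm_lt/(_ (isT : `|0 : int| <= 1)).
rewrite c00B iter_c00_shift0 aj.
by rewrite mulr0 subr0 almost_fixed0 normr1 ltxx.
Qed.

Lemma c00_shift_not_positive_shadowing : ~ positive_shadowing T.
Proof.
have [//|//|V V0 VN] := @c00_shift_not_shadowed `[0, +oo[.
move=> /(_ V V0)[U [/VN[x Ux xN] /(_ x Ux)[a xa]]].
by have [j] := xN a; apply.
Qed.

Lemma c00_shift_not_shadowing : ~ shadowing T.
Proof.
have [//|//|V V0 VN] := @c00_shift_not_shadowed `]-oo, +oo[.
move=> /(_ V V0)[U [/VN[x Ux xN] /(_ x Ux)[a xa]]].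
by have [j] := xN a; apply; exact: (xa (Posz j)).
Qed.

End C00.

Theorem mainTheorem1 (R : realType) (K : numFieldType)
    (hK : K = R :> numFieldType \/ K = R[i] :> numFieldType) :
  [/\ forall n : nat, complete_seminorm (@c00_seminorms K n),
      in_GL (c00_shift K),
      generalized_hyperbolic (@c00_seminorms K) (c00_shift K),
      ~ positive_shadowing (c00_shift K) &
      ~ shadowing (c00_shift K)] /\
  (exists (X : tvsType K) (I : countType) (p : I -> X -> K)
      (T : {linear X -> X}),
    [/\ hausdorff_space X, directed_seminorms p, induces_topology p &
        forall i : I, complete_seminorm (p i)] /\
    [/\ in_GL T, generalized_hyperbolic p T & ~ shadowing T]).
Proof.
have c00_complete n : complete_seminorm (@c00_seminorms K n).
  (* The choice of scalars enters here, through the completeness of [K]. *)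
  apply: complete_c00_norm.
  by case: hK => ->; [exact: complete_norm_real|exact: complete_norm_complex].
split.
  split=> //.
  - exact: c00_shift_in_GL.
  - exact: c00_shift_generalized_hyperbolic.
  - exact: c00_shift_not_positive_shadowing.
  - exact: c00_shift_not_shadowing.
exists (c00 K), nat, (@c00_seminorms K), (c00_shift K); split; split=> //.
- exact: c00_hausdorff.
- exact: c00_seminorms_directed.
- exact: c00_induces.
- exact: c00_shift_in_GL.
- exact: c00_shift_generalized_hyperbolic.
- exact: c00_shift_not_shadowing.
Qed.
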